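(* Let $\mathcal{R}$ be an expansion of $(\mathbb{R},<,+)$ that does not define a dense $\omega$-orderable set. Suppose that $\{X_{r,s} : r,s > 0\}$ is a definable family of closed subsets of $\mathbb{R}^n$ such that $X_{r,s} \subseteq X_{r',s'}$ whenever $r \le r'$ and $s \ge s'$. If $\bigcup_{r,s>0} X_{r,s}$ is somewhere dense, then there are $r',s' > 0$ such that $X_{r',s'}$ has nonempty interior.
   Context: ''Definable'' means first-order definable in $\mathcal{R}$, with parameters allowed; the family is definable if $\{(r,s,x) : r,s>0,\ x \in X_{r,s}\}$ is definable ($r,s$ range over positive reals). A definable subset of $\mathbb{R}^n$ is $\omega$-orderable if it is either finite or admits a definable ordering with order type $\omega$. $\mathcal{R}$ defines a dense $\omega$-orderable set if it defines an $\omega$-orderable subset of $\mathbb{R}$ that is dense in some nonempty open interval. A set is somewhere dense if it is dense in some nonempty open set. *)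

(* Defs.v *)
From HB Require Import structures.
From mathcomp Require Import all_boot all_order all_algebra.
From mathcomp Require Import all_classical all_reals all_analysis.
Import Order.TTheory GRing.Theory Num.Theory.
Import numFieldNormedType.Exports.

Set Implicit Arguments.
Unset Strict Implicit.
Unset Printing Implicit Defensive.

Local Open Scope classical_set_scope.
Local Open Scope ring_scope.

(* The symbols are indexed by their arity; constants are function symbols of
   arity 0. *)
Record language := Language {
  fun_symb : nat -> Type;
  rel_symb : nat -> Type }.

Record structure (L : language) (T : Type) := Structure {
  fun_interp : forall k, fun_symb L k -> ('I_k -> T) -> T;
  rel_interp : forall k, rel_symb L k -> ('I_k -> T) -> Prop }.

(* Terms and formulas over [T] have their free variables in ['I_n]; elements of
   [T] may occur in them as parameters (constructor [Par]). *)
Inductive term (L : language) (T : Type) (n : nat) : Type :=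
| Var of 'I_n
| Par of T
| App k of fun_symb L k & ('I_k -> term L T n).

Inductive formula (L : language) (T : Type) : nat -> Type :=
| Eq n of term L T n & term L T n : formula L T n
| Rel n k of rel_symb L k & ('I_k -> term L T n) : formula L T n
| Neg n of formula L T n : formula L T n
| And n of formula L T n & formula L T n : formula L T n
| Ex n of formula L T n.+1 : formula L T n.

Section Semantics.
Variables (L : language) (T : Type) (M : structure L T).

Fixpoint eval n (v : 'I_n -> T) (t : term L T n) : T :=
  match t with
  | Var i => v i
  | Par a => a
  | App _ f ts => fun_interp M f (fun i => eval v (ts i))
  end.

(* [Ex] binds the variable [ord0] and shifts the free ones by [lift ord0]. *)
Definition extend n (a : T) (v : 'I_n -> T) (i : 'I_n.+1) : T :=
  if unlift ord0 i is Some j then v j else a.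

Fixpoint sat n (phi : formula L T n) : ('I_n -> T) -> Prop :=
  match phi with
  | Eq _ s t => fun v => eval v s = eval v t
  | Rel _ _ r ts => fun v => rel_interp M r (fun i => eval v (ts i))
  | Neg _ psi => fun v => ~ sat psi v
  | And _ psi chi => fun v => sat psi v /\ sat chi v
  | Ex _ psi => fun v => exists a, sat psi (extend a v)
  end.

Definition definable n (A : set 'rV[T]_n) : Prop :=
  exists phi : formula L T n, forall x, A x <-> sat phi (x ord0).

(* [lt] is isomorphic on [D] to [(nat, <)]; in particular it is a strict linear
   order on [D]. *)
Definition order_type_omega (U : Type) (D : set U) (lt : U -> U -> Prop) :=
  exists f : nat -> U, set_bij setT D f /\
    forall i j, lt (f i) (f j) <-> (i < j)%N.

Definition omega_orderable n (D : set 'rV[T]_n) : Prop :=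
  definable D /\
  (finite_set D \/
   exists lt : 'rV[T]_n -> 'rV[T]_n -> Prop,
     definable [set z : 'rV[T]_(n + n) |
       [/\ D (lsubmx z), D (rsubmx z) & lt (lsubmx z) (rsubmx z)]] /\
     order_type_omega D lt).

End Semantics.

Section Expansions.
Variables (R : realType) (L : language) (M : structure L R).

Definition expands_ordered_group : Prop :=
  (exists lt : rel_symb L 2, forall x : 'I_2 -> R,
     rel_interp M lt x <-> x ord0 < x ord_max) /\
  (exists add : fun_symb L 2, forall x : 'I_2 -> R,
     fun_interp M add x = x ord0 + x ord_max).

Definition dense_in (X : topologicalType) (A U : set X) : Prop :=
  U `<=` closure (A `&` U).

Definition somewhere_dense (X : topologicalType) (A : set X) : Prop :=
  exists U : set X, [/\ open U, U !=set0 & dense_in A U].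

Definition defines_dense_omega_orderable_set : Prop :=
  exists D : set R,
    omega_orderable M [set v : 'rV[R]_1 | D (v ord0 ord0)] /\
    exists a b : R, a < b /\ dense_in D `]a, b[.

(* The parameter space is the set of pairs of positive reals, so only the
   members [X r s] with [r, s > 0] matter. *)
Definition definable_family n (X : R -> R -> set 'rV[R]_n) : Prop :=
  definable M [set z : 'rV[R]_(2 + n) |
    let r := lsubmx z ord0 ord0 in
    let s := lsubmx z ord0 ord_max in
    [/\ 0 < r, 0 < s & X r s (rsubmx z)]].

End Expansions.

(* Main.v *)
Require Import Defs.
From HB Require Import structures.
From mathcomp Require Import all_boot all_order all_algebra.
From mathcomp Require Import all_classical all_reals all_analysis.
From mathcomp Require Import lra.
Import Order.TTheory GRing.Theory Num.Theory.
Import numFieldNormedType.Exports.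

Set Implicit Arguments.
Unset Strict Implicit.
Unset Printing Implicit Defensive.

Local Open Scope classical_set_scope.
Local Open Scope ring_scope.

(** Call a member of the family thin when it contains no nonempty open subset
    of the given open set [U] in which the union is dense; suppose that all members
    are thin.

    In dimension one this yields a dense omega-orderable set, in three steps.
    - There is a definable set [Lam] of positive reals that accumulates only at
      [0] ([definable_vanishing_set]). If some member is infinite on a bounded
      interval, [Lam] consists of the lengths of its complementary gaps.
      Otherwise the members are finite there; growing [r] and then shrinking
      [s] gives chains of finite sets, and where such a chain first has an
      infinite union, [Lam] consists of the minimal distances of its members.
    - For each [e > 0] one member meets every interval of length [e], and the
      pair [(r, s)] can be chosen definably from [e] ([selection]), taking [r]
      one above an infimum and [s] as half of a supremum. Restricting [e] to
      [Lam] replaces the uncountable index set by a discrete one.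
    - For [e] and [e'] in [Lam], the member selected for [e] has only finitely
      many left end points of gaps of length at least [e']. Letting [e] and
      [e'] tend to [0] exhausts a dense set by finite sets, which orders it in
      type omega: first by the moment of appearance, then by [<]
      ([dense_omega_orderable]).

    The general case is an induction on the dimension
    ([some_member_has_interiorS]) in the manner of Kuratowski and Ulam. By
    monotonicity the countably many members [X (k+1) (1/(k+1))] are cofinal, so
    the Baire category theorem applies although the family is uncountable. For
    rational [p < q], the projections of the parts of the members over [[p, q]]
    form a definable family of closed sets with dense union, so by induction
    their interiors are dense; and the set of points over which a given cofinal
    member contains all of [[p, q]] is closed with empty interior. A point that
    is generic for these countably many conditions has a fiber that contradicts
    the case of dimension one. *)

(** * Closure properties of definable predicates *)

Section DefinablePredicates.
Variables (L : language) (T : Type) (M : structure L T).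

(** Predicates on assignments ['I_n -> T], rather than subsets of ['rV_n]: a
    definition with bound variables then has the shape of a formula. *)
Definition definable_pred n (P : ('I_n -> T) -> Prop) : Prop :=
  exists phi : formula L T n, forall v, P v <-> sat M phi v.

Definition definable_term n (t : ('I_n -> T) -> T) : Prop :=
  exists tm : term L T n, forall v, t v = Defs.eval M v tm.

Fixpoint shift_term n (t : term L T n) : term L T n.+1 :=
  match t with
  | Var i => Var L T (lift ord0 i)
  | Par a => Par L n.+1 a
  | App _ f ts => App f (fun i => shift_term (ts i))
  end.

Fixpoint subst_term m n (sg : 'I_m -> term L T n) (t : term L T m) :
    term L T n :=
  match t with
  | Var i => sg i
  | Par a => Par L n a
  | App _ f ts => App f (fun i => subst_term sg (ts i))
  end.

Lemma extend_lift n (a : T) (v : 'I_n -> T) i : extend a v (lift ord0 i) = v i.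
Proof. by rewrite /extend liftK. Qed.

Lemma extend0 n (a : T) (v : 'I_n -> T) : extend a v ord0 = a.
Proof. by rewrite /extend unlift_none. Qed.

Lemma eval_shift n a (v : 'I_n -> T) t :
  Defs.eval M (extend a v) (shift_term t) = Defs.eval M v t.
Proof.
elim: t => [i|b|k f ts IH] //=; first exact: extend_lift.
by congr fun_interp; apply/funext.
Qed.

Lemma eval_subst m n (sg : 'I_m -> term L T n) v t :
  Defs.eval M v (subst_term sg t) = Defs.eval M (fun i => Defs.eval M v (sg i)) t.
Proof. by elim: t => [i|b|k f ts IH] //=; congr fun_interp; apply/funext. Qed.

(** Under a quantifier the substituted terms are shifted, so that they do not
    capture the newly bound variable. *)
Lemma definable_pred_subst m n (P : ('I_m -> T) -> Prop)
    (sg : 'I_m -> term L T n) :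
  definable_pred P -> definable_pred (fun v => P (fun i => Defs.eval M v (sg i))).
Proof.
case=> phi Pphi.
suff [psi psiP] : exists psi : formula L T n,
    forall v, sat M psi v <-> sat M phi (fun i => Defs.eval M v (sg i)).
  by exists psi => v; rewrite psiP.
elim: phi n sg {P Pphi} => {m}
  [m s t|m k r ts|m phi IH|m phi IH1 chi IH2|m phi IH] n sg.
- exists (Eq (subst_term sg s) (subst_term sg t)) => v /=.
  by rewrite !eval_subst.
- exists (Rel r (fun i => subst_term sg (ts i))) => v /=.
  suff -> : (fun i => Defs.eval M v (subst_term sg (ts i))) =
    (fun i => Defs.eval M (fun j => Defs.eval M v (sg j)) (ts i)) by [].
  by apply/funext => i; rewrite eval_subst.
- by have [psi h] := IH n sg; exists (Neg psi) => v /=; rewrite h.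
- have [psi1 h1] := IH1 n sg; have [psi2 h2] := IH2 n sg.
  by exists (And psi1 psi2) => v /=; rewrite h1 h2.
- pose sg' (i : 'I_m.+1) : term L T n.+1 :=
    if unlift ord0 i is Some j then shift_term (sg j) else Var L T ord0.
  have [psi h] := IH n.+1 sg'; exists (Ex psi) => v /=.
  have E a : (fun i => Defs.eval M (extend a v) (sg' i)) =
             extend a (fun i => Defs.eval M v (sg i)).
    apply/funext => i; rewrite /sg'; case: unliftP => [j|] ->.
      by rewrite eval_shift extend_lift.
    by rewrite /= !extend0.
  by split=> -[a]; [rewrite h E|rewrite -E -h] => ?; exists a.
Qed.

Lemma definable_pred_ext n (P Q : ('I_n -> T) -> Prop) :
  (forall v, P v <-> Q v) -> definable_pred P -> definable_pred Q.
Proof. by move=> PQ [phi h]; exists phi => v; rewrite -PQ. Qed.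

Lemma definable_and n (P Q : ('I_n -> T) -> Prop) :
  definable_pred P -> definable_pred Q -> definable_pred (fun v => P v /\ Q v).
Proof. by move=> [p hp] [q hq]; exists (And p q) => v /=; rewrite hp hq. Qed.

Lemma definable_and3 n (P Q S : ('I_n -> T) -> Prop) :
  definable_pred P -> definable_pred Q -> definable_pred S ->
  definable_pred (fun v => [/\ P v, Q v & S v]).
Proof.
move=> hP hQ hS; apply: definable_pred_ext (definable_and hP (definable_and hQ hS)).
by move=> v; split=> [[? []]|[]].
Qed.

Lemma definable_and4 n (P Q S U : ('I_n -> T) -> Prop) :
  definable_pred P -> definable_pred Q -> definable_pred S ->
  definable_pred U -> definable_pred (fun v => [/\ P v, Q v, S v & U v]).
Proof.
move=> hP hQ hS hU.
apply: definable_pred_ext (definable_and hP (definable_and3 hQ hS hU)).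
by move=> v; split=> [[? []]|[]].
Qed.

Lemma definable_not n (P : ('I_n -> T) -> Prop) :
  definable_pred P -> definable_pred (fun v => ~ P v).
Proof. by move=> [p hp]; exists (Neg p) => v /=; rewrite hp. Qed.

Lemma definable_or n (P Q : ('I_n -> T) -> Prop) :
  definable_pred P -> definable_pred Q -> definable_pred (fun v => P v \/ Q v).
Proof.
move=> hP hQ; apply: (@definable_pred_ext _ (fun v => ~ (~ P v /\ ~ Q v))).
  by move=> v; split=> [/not_andP[]/contrapT ?|[p []|q []] //]; [left|right].
by apply: definable_not; apply: definable_and; apply: definable_not.
Qed.

Lemma definable_imp n (P Q : ('I_n -> T) -> Prop) :
  definable_pred P -> definable_pred Q -> definable_pred (fun v => P v -> Q v).
Proof.
move=> hP hQ; apply: (@definable_pred_ext _ (fun v => ~ P v \/ Q v)).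
  by move=> v; rewrite implyE.
by apply: definable_or => //; apply: definable_not.
Qed.

Lemma definable_iff n (P Q : ('I_n -> T) -> Prop) :
  definable_pred P -> definable_pred Q ->
  definable_pred (fun v => P v <-> Q v).
Proof. by move=> hP hQ; apply: definable_and; apply: definable_imp. Qed.

(** The bound variable is number [ord0] of the enlarged context, in accordance
    with [extend]. *)
Lemma definable_ex n (P : ('I_n -> T) -> T -> Prop) :
  definable_pred (fun w : 'I_n.+1 -> T =>
    P (fun i => w (lift ord0 i)) (w ord0)) ->
  definable_pred (fun v => exists a, P v a).
Proof.
move=> [p hp]; exists (Ex p) => v /=.
have E a : P v a <-> sat M p (extend a v).
  rewrite -hp extend0; suff -> : (fun i => extend a v (lift ord0 i)) = v by [].
  by apply/funext => i; rewrite extend_lift.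
by split=> -[a /E ?]; exists a.
Qed.

Lemma definable_all n (P : ('I_n -> T) -> T -> Prop) :
  definable_pred (fun w : 'I_n.+1 -> T =>
    P (fun i => w (lift ord0 i)) (w ord0)) ->
  definable_pred (fun v => forall a, P v a).
Proof.
move=> hP; apply: (@definable_pred_ext _ (fun v => ~ exists a, ~ P v a)).
  by move=> v; split=> [/forallNP h a|h [a]]; [apply: contrapT|].
by apply/definable_not/definable_ex/definable_not.
Qed.

Lemma definable_eq n (s t : ('I_n -> T) -> T) :
  definable_term s -> definable_term t -> definable_pred (fun v => s v = t v).
Proof. by move=> [s' hs] [t' ht]; exists (Eq s' t') => v; rewrite hs ht. Qed.

Lemma definable_var n (i : 'I_n) : definable_term (fun v => v i).
Proof. by exists (Var L T i). Qed.

Lemma definable_par n (a : T) : definable_term (fun _ : 'I_n -> T => a).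
Proof. by exists (Par L n a). Qed.

Lemma definable_comp m n (P : ('I_m -> T) -> Prop)
    (t : 'I_m -> ('I_n -> T) -> T) :
  definable_pred P -> (forall i, definable_term (t i)) ->
  definable_pred (fun v => P (fun i => t i v)).
Proof.
move=> hP /(_ _)/cid ht; pose sg i := projT1 (ht i).
apply: definable_pred_ext (definable_pred_subst sg hP) => v.
suff -> : (fun i => Defs.eval M v (sg i)) = (fun i => t i v) by [].
by apply/funext => i; rewrite /sg; case: (ht i) => tm /= ->.
Qed.

Definition definable1 (P : T -> Prop) : Prop :=
  definable_pred (fun v : 'I_1 -> T => P (v ord0)).

Definition definable2 (P : T -> T -> Prop) : Prop :=
  definable_pred (fun v : 'I_2 -> T => P (v ord0) (v ord_max)).

Definition definable3 (P : T -> T -> T -> Prop) : Prop :=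
  definable_pred (fun v : 'I_3 -> T => P (v ord0) (v (inord 1)) (v ord_max)).

Lemma definable1_comp n P (s : ('I_n -> T) -> T) :
  definable1 P -> definable_term s -> definable_pred (fun v => P (s v)).
Proof. by move=> hP hs; apply: (definable_comp (t := fun=> s) hP). Qed.

Lemma definable2_comp n P (s t : ('I_n -> T) -> T) :
  definable2 P -> definable_term s -> definable_term t ->
  definable_pred (fun v => P (s v) (t v)).
Proof.
move=> hP hs ht.
apply: (definable_comp
  (t := fun i : 'I_2 => if val i is 0%N then s else t) hP).
by move=> -[[|?] ?].
Qed.

Lemma definable3_comp n P (r s t : ('I_n -> T) -> T) :
  definable3 P -> definable_term r -> definable_term s -> definable_term t ->
  definable_pred (fun v => P (r v) (s v) (t v)).
Proof.
move=> hP hr hs ht.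
have := definable_comp (t := fun i : 'I_3 =>
  if val i is 0%N then r else if val i is 1%N then s else t) hP.
rewrite /= inordK //; apply.
by move=> -[[|[|?]] ?].
Qed.

End DefinablePredicates.

Section DefinableOrderedGroup.
Variables (R : realType) (L : language) (M : structure L R).
Hypothesis hM : expands_ordered_group M.

Lemma definable_add n (s t : ('I_n -> R) -> R) :
  definable_term M s -> definable_term M t ->
  definable_term M (fun v => s v + t v).
Proof.
case: hM => _ [add addE] [s' hs] [t' ht].
exists (App add (fun i : 'I_2 => if val i is 0%N then s' else t')) => v /=.
by rewrite addE /= hs ht.
Qed.

Lemma definable_lt n (s t : ('I_n -> R) -> R) :
  definable_term M s -> definable_term M t ->
  definable_pred M (fun v => s v < t v).
Proof.
case: hM => -[lt ltE] _ [s' hs] [t' ht].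
exists (Rel lt (fun i : 'I_2 => if val i is 0%N then s' else t')) => v /=.
by rewrite ltE /= hs ht.
Qed.

Lemma definable_le n (s t : ('I_n -> R) -> R) :
  definable_term M s -> definable_term M t ->
  definable_pred M (fun v => s v <= t v).
Proof.
move=> hs ht; apply: (@definable_pred_ext _ _ _ _ (fun v => ~ (t v < s v))).
  by move=> v; rewrite leNgt; split => /negP.
by apply: definable_not; apply: definable_lt.
Qed.

End DefinableOrderedGroup.

(** Reads off the definability of a predicate from its shape; the hypotheses on
    the definability of its atoms are taken from the context. *)
Ltac definability :=
  lazymatch goal with
  | |- definable1 _ _ => unfold definable1; definability
  | |- definable2 _ _ => unfold definable2; definability
  | |- definable3 _ _ => unfold definable3; definability
  | |- definable_term _ (fun v => v ?i) => exact: definable_var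
  | |- definable_term _ (fun _ => ?a) => exact: definable_par
  | |- definable_term _ (fun v => @?s v + @?t v) =>
      apply: (@definable_add _ _ _ _ _ s t) => //; definability
  | |- definable_pred _ (fun v => @?P v /\ @?Q v) =>
      apply: (@definable_and _ _ _ _ P Q); definability
  | |- definable_pred _ (fun v => [/\ @?P v, @?Q v & @?S v]) =>
      apply: (@definable_and3 _ _ _ _ P Q S); definability
  | |- definable_pred _ (fun v => [/\ @?P v, @?Q v, @?S v & @?U v]) =>
      apply: (@definable_and4 _ _ _ _ P Q S U); definability
  | |- definable_pred _ (fun v => @?P v \/ @?Q v) =>
      apply: (@definable_or _ _ _ _ P Q); definability
  | |- definable_pred _ (fun v => ~ @?P v) =>
      apply: (@definable_not _ _ _ _ P); definability
  | |- definable_pred _ (fun v => @?P v <-> @?Q v) =>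
      apply: (@definable_iff _ _ _ _ P Q); definability
  | |- definable_pred _ (fun v => @?P v -> @?Q v) =>
      apply: (@definable_imp _ _ _ _ P Q); definability
  | |- definable_pred _ (fun v => exists x, @?P v x) =>
      apply: (@definable_ex _ _ _ _ P); cbv beta; definability
  | |- definable_pred _ (fun v => forall x, @?P v x) =>
      apply: (@definable_all _ _ _ _ P); cbv beta; definability
  | |- definable_pred _ (fun v => is_true (@?s v < @?t v)) =>
      apply: (@definable_lt _ _ _ _ _ s t) => //; definability
  | |- definable_pred _ (fun v => is_true (@?s v <= @?t v)) =>
      apply: (@definable_le _ _ _ _ _ s t) => //; definability
  | |- definable_pred _ (fun v => @?s v = @?t v) =>
      apply: (@definable_eq _ _ _ _ s t); definability
  | H : definable3 _ ?P |- definable_pred _ (fun v => ?P (@?r v) (@?s v) (@?t v)) =>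
      apply: (@definable3_comp _ _ _ _ P r s t) => //; definability
  | H : definable2 _ ?P |- definable_pred _ (fun v => ?P (@?s v) (@?t v)) =>
      apply: (@definable2_comp _ _ _ _ P s t) => //; definability
  | H : definable1 _ ?P |- definable_pred _ (fun v => ?P (@?s v)) =>
      apply: (@definable1_comp _ _ _ _ P s) => //; definability
  | _ => idtac
  end.

(** * Orders with finite initial segments *)

Section StrictOrders.
Variables (T : pointedType) (lt : T -> T -> Prop).

Lemma finite_minimal (A : set T) :
  (forall x, A x -> ~ lt x x) ->
  (forall x y z, A x -> A y -> A z -> lt x y -> lt y z -> lt x z) ->
  finite_set A -> A !=set0 -> exists x, A x /\ forall y, A y -> ~ lt y x.
Proof.
move=> irr trans /finite_seqP[s sE]; rewrite {}sE in irr trans *.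
elim: s irr trans => [_ _ [x]//|a s IH irr trans _].
case: s IH irr trans => [_ irr _|b s IH irr trans].
  exists a; split=> [|y]; first by rewrite /= inE.
  by rewrite /= inE => /eqP ->; apply: irr; rewrite /= inE.
have sub z : z \in b :: s -> [set` a :: b :: s] z.
  by move=> zs; rewrite /= inE zs orbT.
have [|||x [xs xmin]] := IH.
- by move=> z /sub; exact: irr.
- by move=> x y z /sub ? /sub ? /sub ?; apply: trans.
- by exists b; rewrite /= inE eqxx.
have [ax|nax] := pselect (lt a x).
  have aA : [set` a :: b :: s] a by rewrite /= inE eqxx.
  exists a; split=> // y; rewrite /= inE => /orP[/eqP ->|ys]; first exact: irr.
  by move=> ya; apply: (xmin y ys); apply: (trans y a x) => //; exact: sub.
exists x; split; first exact: sub.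
by move=> y; rewrite /= inE => /orP[/eqP ->//|ys]; exact: xmin.
Qed.

Variable D : set T.
Hypothesis irr : forall x, D x -> ~ lt x x.
Hypothesis trans : forall x y z, D x -> D y -> D z ->
  lt x y -> lt y z -> lt x z.
Hypothesis total : forall x y, D x -> D y -> x <> y -> lt x y \/ lt y x.
Hypothesis init_finite : forall x, D x -> finite_set [set y | D y /\ lt y x].
Hypothesis D_infinite : infinite_set D.

Let minimum (A : set T) := get [set x | A x /\ forall y, A y -> ~ lt y x].

Let minimumP A : A `<=` D -> A !=set0 ->
  A (minimum A) /\ forall y, A y -> ~ lt y (minimum A).
Proof.
move=> AD [x Ax].
suff [m Pm] : exists m, A m /\ forall y, A y -> ~ lt y m.
  exact: (@getPex _ [set x | A x /\ forall y, A y -> ~ lt y x] (ex_intro _ m Pm)).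
have [[y [Ay yx]]|noy] := pselect (exists y, A y /\ lt y x); last first.
  by exists x; split=> // y Ay yx; apply: noy; exists y.
have [m [[Am mx] mmin]] : exists m, (A m /\ lt m x) /\
    forall y, A y /\ lt y x -> ~ lt y m.
  apply: (@finite_minimal [set y | A y /\ lt y x]).
  - by move=> z [/AD Dz _]; exact: irr.
  - by move=> u v w [/AD ? _] [/AD ? _] [/AD ? _]; apply: trans.
  - apply: sub_finite_set (init_finite (AD _ Ax)).
    by move=> z [/AD ? ?]; split.
  - by exists y.
exists m; split=> // z Az zm; apply: (mmin z) => //; split=> //.
by apply: (trans _ _ _ zm mx); exact: AD.
Qed.

Let remaining := fix remaining n :=
  if n is m.+1 then remaining m `\ minimum (remaining m) else D.

Let enumeration n := minimum (remaining n).

(** Enumerate [D] by repeatedly removing its least element; an element that is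
    never removed would have infinitely many predecessors. *)
Lemma finite_initial_order_type_omega : order_type_omega D lt.
Proof.
have remD n : remaining n `<=` D.
  by elim: n => [//|n IH] x [/IH].
have reminf n : infinite_set (remaining n).
  elim: n => [//|n IH] /= fin; apply: IH.
  have : finite_set (remaining n `\ minimum (remaining n) `|`
      [set minimum (remaining n)]).
    by rewrite finite_setU; split=> //; exact: finite_set1.
  apply: sub_finite_set => x remx.
  have [->|xm] := eqVneq x (minimum (remaining n)); first by right.
  by left; split=> // /= xm'; rewrite xm' eqxx in xm.
have enumP n : remaining n (enumeration n) /\
    forall y, remaining n y -> ~ lt y (enumeration n).
  by apply: minimumP => //; exact: infinite_setN0.
have enumD n : D (enumeration n) by apply: (@remD n); case: (enumP n).
have later i j : (i < j)%N -> remaining j `<=` remaining i `\ enumeration i.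
  elim: j => [//|j IH]; rewrite ltnS leq_eqVlt => /orP[/eqP <-//|ij].
  by move=> x [remx _]; exact: IH.
have ltmono i j : (i < j)%N -> lt (enumeration i) (enumeration j).
  move=> ij; have [remj neq] := later _ _ ij _ (enumP j).1.
  have [//|ji] := total (enumD i) (enumD j) (fun e => neq (esym e)).
  by case: ((enumP i).2 _ remj).
have enum_inj i j : enumeration i = enumeration j -> i = j.
  move=> eij; have [ij|ji|//] := ltngtP i j.
    by have := ltmono _ _ ij; rewrite eij => /(irr (enumD _)).
  by have := ltmono _ _ ji; rewrite eij => /(irr (enumD _)).
exists enumeration; split; last first.
  move=> i j; split=> [lij|]; last exact: ltmono.
  rewrite ltnNge leq_eqVlt; apply/negP => /orP[/eqP ji|/ltmono ji].
    by move: lij; rewrite ji => /(irr (enumD _)).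
  exact: (irr (enumD i)) (trans (enumD i) (enumD j) (enumD i) lij ji).
split=> [n _|i j _ _|x Dx]; [exact: enumD|exact: enum_inj|].
apply: contrapT => nx; have remx n : remaining n x.
  elim: n => [//|n IH]; split=> //= xm; apply: nx; exists n => //.
have : finite_set (enumeration @^-1` [set y | D y /\ lt y x]).
  apply: finite_preimage; last exact: init_finite.
  by move=> i j _ _; exact: enum_inj.
suff -> : enumeration @^-1` [set y | D y /\ lt y x] = setT by exact: infinite_nat.
rewrite -subTset => n _; split; first exact: enumD.
have [|//|xn] := total (enumD n) Dx; first by move=> e; apply: nx; exists n.
by case: ((enumP n).2 _ (remx n)).
Qed.

End StrictOrders.

(** * Gaps and minimal distances of closed sets of reals *)

Section RealLine.
Variable R : realType.
Implicit Types (S C : set R) (a b e x y z : R).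

Lemma separated_finite S a b e : 0 < e -> (forall x, S x -> a <= x <= b) ->
  (forall x y, S x -> S y -> x < y -> x + e <= y) -> finite_set S.
Proof.
move=> e0 Sab sep; pose f x := Num.truncn ((x - a) / e).
have f0 x : S x -> 0 <= (x - a) / e.
  by move=> /Sab /andP[ax _]; rewrite divr_ge0 ?subr_ge0 // ltW.
have f_lt x y : S x -> S y -> x < y -> (f x < f y)%N.
  move=> Sx Sy xy; rewrite /f truncn_lt_nat ?f0 //.
  have: ((y - a) / e) < (f y).+1%:R.
    by rewrite -truncn_lt_nat ?f0.
  rewrite -natr1; have := sep _ _ Sx Sy xy => xey.
  suff : (x - a) / e + 1 <= (y - a) / e by lra.
  by rewrite -[X in _ + X](divff (lt0r_neq0 e0)) -mulrDl ler_pM2r ?invr_gt0 //; lra.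
have f_inj : {in S &, injective f}.
  move=> x y /set_mem Sx /set_mem Sy fxy; have [xy|yx|//] := ltgtP x y.
    by have := f_lt _ _ Sx Sy xy; rewrite fxy ltnn.
  by have := f_lt _ _ Sy Sx yx; rewrite fxy ltnn.
rewrite -(eq_finite_set (inj_card_eq f_inj)).
apply: (@sub_finite_set _ _ `I_(Num.truncn ((b - a) / e)).+1) => //.
move=> _ [x Sx <-]; have /andP[ax xb] := Sab _ Sx.
by rewrite /= ltnS; apply: le_truncn; rewrite ler_pM2r ?invr_gt0 //; lra.
Qed.

End RealLine.

Section ClosedSets.
Variable R : realType.
Implicit Types (S C L : set R) (a b e x y z : R).

Lemma infinite_close_pair S a b e : 0 < e -> (forall x, S x -> a <= x <= b) ->
  infinite_set S -> exists x y, [/\ S x, S y, x < y & y < x + e].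
Proof.
move=> e0 Sab; apply: contra_notP => none; apply: separated_finite e0 Sab _.
move=> x y Sx Sy xy; rewrite leNgt; apply/negP => yx.
by apply: none; exists x, y.
Qed.

Lemma closed_last C z w : closed C -> C z -> z < w -> ~ C w ->
  exists x, [/\ C x, z <= x, x < w & forall y, x < y -> y <= w -> ~ C y].
Proof.
move=> Ccl Cz zw nCw; pose A := C `&` [set y | z <= y <= w].
have Az : A z by split=> //=; rewrite lexx ltW.
have Aub : has_ubound A by exists w => y [_ /andP[]].
have Acl : closed A.
  apply: closedI => //; have -> : [set y | z <= y <= w] = `[z, w]%classic.
    by apply/seteqP; split=> y /=; rewrite in_itv.
  exact: interval_closed.
have [] : A (sup A).
  by rewrite [A in A (sup _)](closure_id A).1//; apply: closure_sup => //; exists z.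
move=> Csup /andP[zsup supw]; exists (sup A); split=> //.
  by rewrite lt_neqAle supw andbT; apply/eqP => e; apply: nCw; rewrite -e.
move=> y supy yw Cy; have : y <= sup A.
  apply: ub_le_sup => //; split=> //=; rewrite yw andbT.
  exact: le_trans zsup (ltW supy).
by rewrite leNgt supy.
Qed.

Lemma closed_first C w z : closed C -> C z -> w < z -> ~ C w ->
  exists x, [/\ C x, w < x, x <= z & forall y, w <= y -> y < x -> ~ C y].
Proof.
move=> Ccl Cz wz nCw; pose C' : set R := [set x | C (- x)].
have C'cl : closed C'.
  have : continuous (fun x : R => - x) by move=> x; exact: opp_continuous.
  by move=> /continuous_closedP; apply.
have [| |/=|x [C'x zx xw xmax]] := @closed_last C' (- z) (- w) C'cl.
- by rewrite /C' /= opprK.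
- by rewrite ltrN2.
- by rewrite /C' /= opprK.
exists (- x); split; [exact: C'x|lra|lra|].
by move=> y wy yx Cy; apply: (xmax (- y)); rewrite /C' /= ?opprK //; lra.
Qed.

(** Infinite, with [0] as its only accumulation point in [[0, +oo)]. *)
Definition vanishing L : Prop :=
  [/\ forall l, L l -> 0 < l,
      forall e, 0 < e -> exists l, L l /\ l < e
    & forall e, 0 < e -> finite_set [set l | L l /\ e <= l]].

Definition gap C x l : Prop :=
  [/\ 0 < l, C x, C (x + l) & forall y, x < y -> y < x + l -> ~ C y].

Definition no_interval C a b : Prop :=
  forall x y, a <= x -> x < y -> y <= b -> exists w, [/\ x < w, w < y & ~ C w].

Lemma finite_differences S S' : finite_set S -> finite_set S' ->
  finite_set [set l | exists x y, [/\ S x, S' y & y = x + l]].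
Proof.
move=> fS fS'; have := finite_image (fun p => p.2 - p.1) (finite_setX fS fS').
apply: sub_finite_set => l [x [y [Sx Sy yE]]]; exists (x, y) => //=.
by rewrite yE addrAC subrr add0r.
Qed.

(** Gaps longer than [e] have [e]-separated end points; and a gap separates any
    two points of [C]. *)
Lemma gap_lengths_vanishing C a b : closed C -> (forall x, C x -> a <= x <= b) ->
  no_interval C a b -> infinite_set C -> vanishing [set l | exists x, gap C x l].
Proof.
move=> Ccl Cab nint Cinf; split=> [l [x []]//|e e0|e e0].
  have [z [z' [Cz Cz' zz' z'z]]] := infinite_close_pair e0 Cab Cinf.
  have /andP[az _] := Cab _ Cz; have /andP[_ z'b] := Cab _ Cz'.
  have [w [zw wz' nCw]] := nint _ _ az zz' z'b.
  have [x [Cx zx xw xmax]] := closed_last Ccl Cz zw nCw.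
  have [y [Cy wy yz' ymin]] := closed_first Ccl Cz' wz' nCw.
  have E : x + (y - x) = y by rewrite addrC subrK.
  exists (y - x); split; last by lra.
  exists x; split; rewrite ?E //; first by lra.
  by move=> v xv vy; have [vw|wv] := leP v w; [apply: xmax|apply: ymin => //; apply: ltW].
pose S := [set x | exists l, gap C x l /\ e <= l].
pose S' := [set y | exists x l, [/\ gap C x l, e <= l & y = x + l]].
have fS : finite_set S.
  apply: (@separated_finite _ _ a b e) => // [x [l [[_ /Cab]]]//|].
  move=> x y [l [[l0 _ _ gapx] el]] [l' [[_ Cy _ _] _]] xy.
  rewrite leNgt; apply/negP => yx; apply: gapx Cy => //; lra.
have fS' : finite_set S'.
  apply: (@separated_finite _ _ a b e) => //.
    by move=> y [x [l [[_ _ /Cab ? _] _ ->]]].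
  move=> y y' [x [l [[_ _ Cy _] _ yE]]] [x' [l' [[_ _ _ gapx'] el' ->]]] yy'.
  rewrite leNgt; apply/negP => y'y; apply: gapx' Cy; rewrite -yE //; lra.
apply: sub_finite_set (finite_differences fS fS') => l [[x gapx] el].
by exists x, (x + l); split=> //; [exists l|exists x, l].
Qed.

Definition min_distance C l : Prop :=
  (exists x, C x /\ C (x + l)) /\
  forall x y, C x -> C y -> x < y -> x + l <= y.

(** Members of the chain with minimal distance at least [e] have an
    [e]-separated, hence finite, union. *)
Lemma min_distances_vanishing (P : set R) (C : R -> set R) a b :
  (forall t t', P t -> P t' -> C t `<=` C t' \/ C t' `<=` C t) ->
  (forall t, P t -> finite_set (C t)) ->
  (forall t, P t -> forall x, C t x -> a <= x <= b) ->
  infinite_set [set x | exists t, P t /\ C t x] ->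
  vanishing [set l | 0 < l /\ exists t, P t /\ min_distance (C t) l].
Proof.
move=> chain Cfin Cab Cinf; split=> [l []//|e e0|e e0].
  have Uab x : (exists t, P t /\ C t x) -> a <= x <= b.
    by move=> [t [Pt]]; exact: Cab.
  have [x [y [[t [Pt Cx]] [t' [Pt' Cy]] xy yx]]] :=
    infinite_close_pair e0 Uab Cinf.
  have [u [Pu {}Cx {}Cy]] : exists u, [/\ P u, C u x & C u y].
    have [s|s] := chain _ _ Pt Pt'; first by exists t'; split=> //; exact: s.
    by exists t; split=> //; exact: s.
  have [||||[x0 y0] [[/= Cx0 Cy0 x0y0] minxy]] :=
      @finite_minimal (R * R)%type (fun p q => p.2 - p.1 < q.2 - q.1)
        [set p | [/\ C u p.1, C u p.2 & p.1 < p.2]].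
  - by move=> p _; rewrite ltxx.
  - by move=> p q r _ _ _; exact: lt_trans.
  - by apply: sub_finite_set (finite_setX (Cfin _ Pu) (Cfin _ Pu)) => -[p q] [].
  - by exists (x, y).
  exists (y0 - x0); split.
    split; first by rewrite subr_gt0.
    exists u; split=> //; split; first by exists x0; rewrite addrC subrK.
    move=> v w Cv Cw vw; have := minxy (v, w) (And3 Cv Cw vw).
    by move=> /= /negP; rewrite -leNgt; lra.
  by have := minxy (x, y) (And3 Cx Cy xy) => /= /negP; rewrite -leNgt; lra.
pose S := [set x | exists t l, [/\ P t, min_distance (C t) l, e <= l & C t x]].
have fS : finite_set S.
  apply: (@separated_finite _ _ a b e) => // [x [t [l [Pt _ _ Cx]]]|].
    exact: Cab Cx.
  move=> x y [t [l [Pt [_ ml] el Cx]]] [t' [l' [Pt' [_ ml'] el' Cy]]] xy.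
  have [s|s] := chain _ _ Pt Pt'.
    by have := ml' _ _ (s _ Cx) Cy xy; lra.
  by have := ml _ _ Cx (s _ Cy) xy; lra.
apply: sub_finite_set (finite_differences fS fS) => l [[_ [t [Pt ml]]] el].
have [[x [Cx Cxl]] _] := ml.
by exists x, (x + l); split=> //; exists t, l.
Qed.

End ClosedSets.

(** * Omega-orderable sets exhausted by finite sets *)

Section OmegaOrderable.
Variables (R : realType) (L : language) (M : structure L R).
Hypothesis hM : expands_ordered_group M.

(** [x] precedes [y] when it enters [G t] earlier as [t] decreases to [0]; ties
    are broken by [<]. Every predecessor of [y] lies in any finite set [G t]
    that contains [y]. *)
Lemma omega_orderable_filtration (G : R -> R -> Prop) :
  definable2 M G -> (forall t, 0 < t -> finite_set (G t)) ->
  (forall t u, 0 < t -> t <= u -> G u `<=` G t) ->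
  omega_orderable M [set v : 'rV[R]_1 | exists t, 0 < t /\ G t (v ord0 ord0)].
Proof.
move=> Gdef Gfin Gmono; pose D x := exists t, 0 < t /\ G t x.
pose lt x y := (exists t, [/\ 0 < t, G t x & ~ G t y]) \/
  ((forall t, 0 < t -> (G t x <-> G t y)) /\ x < y).
have Ddef : definable1 M D by rewrite /D; definability.
have ltdef : definable2 M lt by rewrite /lt; definability.
have DDltdef : definable2 M (fun x y => [/\ D x, D y & lt x y]) by definability.
(* A point of [G u] outside [G t] enters later than [t]. *)
have entry x t u : 0 < t -> G u x -> ~ G t x -> u < t.
  by move=> t0 Gu; apply: contra_notT; rewrite -leNgt => /(Gmono _ _ t0); apply.
have irr x : ~ lt x x by move=> [[t []]//|[_]]; rewrite ltxx.
have trans x y z : lt x y -> lt y z -> lt x z.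
  move=> [[t [t0 xt yt]]|[xy ltxy]] [[u [u0 yu zu]]|[yz ltyz]].
  - left; exists u; split=> //.
    by apply: Gmono xt => //; apply/ltW/(entry y).
  - by left; exists t; split=> //; rewrite -yz.
  - by left; exists u; split=> //; rewrite xy.
  - by right; split=> [t t0|]; [rewrite xy// yz|exact: lt_trans ltyz].
have total x y : x <> y -> lt x y \/ lt y x.
  move=> xy.
  have [[t [t0 tx]]|sep] := pselect (exists t, 0 < t /\ ~ (G t x <-> G t y)).
    have [xt|xt] := pselect (G t x).
      by left; left; exists t; split=> // yt; apply: tx.
    right; left; exists t; split=> //; apply: contrapT => yt.
    by apply: tx.
  have {}sep t : 0 < t -> (G t x <-> G t y).
    by move=> t0; apply: contrapT => tx; apply: sep; exists t.
  have [ltxy|ltyx|//] := ltgtP x y; [by left; right|right; right].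
  by split=> // t t0; rewrite sep.
have init_sub t x y : 0 < t -> G t y -> lt x y -> G t x.
  move=> t0 yt [[u [u0 xu yu]]|[-> //]].
  by apply: Gmono xu => //; apply/ltW/(entry y).
split.
  by have [phi phiP] := Ddef; exists phi => v; rewrite -phiP.
have [fin|inf] := pselect (finite_set [set v : 'rV[R]_1 | D (v ord0 ord0)]).
  by left.
right; exists (fun v w => lt (v ord0 ord0) (w ord0 ord0)); split.
  have [phi phiP] := DDltdef; exists phi => z; rewrite -phiP /= !mxE.
  have -> : lshift 1 (ord0 : 'I_1) = ord0 by apply/val_inj.
  by have -> : rshift 1 (ord0 : 'I_1) = ord_max by apply/val_inj.
have rV1_inj (v w : 'rV[R]_1) : v ord0 ord0 = w ord0 ord0 -> v = w.
  by move=> vw; apply/rowP => i; rewrite !ord1.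
apply: finite_initial_order_type_omega.
- by move=> v _; exact: irr.
- by move=> u v w _ _ _; exact: trans.
- by move=> v w _ _ vw; apply: total => /rV1_inj.
- move=> v [t [t0 vt]].
  have : finite_set ((fun w : 'rV[R]_1 => w ord0 ord0) @^-1` G t).
    by apply: finite_preimage (Gfin _ t0) => u w _ _; exact: rV1_inj.
  by apply: sub_finite_set => w [_ wv] /=; exact: init_sub wv.
- exact: inf.
Qed.

(** The points are left end points of gaps of length at least [e'] in [Z e]:
    finitely many for given [e] and [e'], as they are [e']-separated. They come
    close to every point, since [Z e] meets every interval of length [e] but
    contains none. *)
Lemma dense_omega_orderable (Lam : set R) (Z : R -> R -> Prop) (a b : R) :
  a < b -> vanishing Lam -> definable1 M Lam -> definable2 M Z ->
  (forall e, Lam e -> closed (Z e)) ->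
  (forall e, Lam e -> no_interval (Z e) a b) ->
  (forall e, Lam e -> forall c, a <= c -> c + e <= b ->
    exists z, [/\ Z e z, c <= z & z <= c + e]) ->
  defines_dense_omega_orderable_set M.
Proof.
move=> ab [Lam0 Lam_small Lam_fin] Lamdef Zdef Zcl Znint Zdense.
pose F e e' x := [/\ a < x, x < b, Z e x &
  forall y, x < y -> y < x + e' -> ~ Z e y].
pose G t x := exists e e', (Lam e /\ t <= e) /\ (Lam e' /\ t <= e') /\ F e e' x.
have Gdef : definable2 M G by rewrite /G /F; definability.
exists (fun x => exists t, 0 < t /\ G t x); split.
  apply: omega_orderable_filtration => //.
    move=> t t0; pose Lt := [set l | Lam l /\ t <= l].
    have : finite_set (\bigcup_(e in Lt) \bigcup_(e' in Lt) [set x | F e e' x]).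
      apply: bigcup_finite; first exact: Lam_fin.
      move=> e _; apply: bigcup_finite; first exact: Lam_fin.
      move=> e' [/Lam0 e'0 _]; apply: (@separated_finite _ _ a b e') => //.
        by move=> x [/ltW -> /ltW ->].
      move=> x y [_ _ _ gapx] [_ _ Zy _] xy.
      by rewrite leNgt; apply/negP => yx; exact: gapx Zy.
    apply: sub_finite_set => x [e [e' [et [et' Fx]]]].
    by exists e => //; exists e'.
  move=> t u t0 tu x [e [e' [[Le ue] [[Le' ue'] Fx]]]]; exists e, e'.
  by split; [|split] => //; split=> //; exact: le_trans tu _.
exists a, b; split=> // x; rewrite /= in_itv /= => /andP[ax xb] B.
move=> /nbhs_ballP[d /= d0 dB].
pose c1 := Num.max a (x - d); pose c2 := Num.min b (x + d).
have c1x : c1 < x by rewrite gt_max ax /=; lra.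
have xc2 : x < c2 by rewrite lt_min xb /=; lra.
have ac1 : a <= c1 by rewrite le_max lexx.
have c2b : c2 <= b by rewrite ge_min lexx.
have c1d : x - d <= c1 by rewrite le_max lexx orbT.
have c2d : c2 <= x + d by rewrite ge_min lexx orbT.
(* A quarter of the way into the window ]c1, c2[, so that a point of [Z e]
   within [e] lies inside it. *)
have [e [Le e_small]] : exists e, Lam e /\ e < (c2 - c1) / 4.
  by apply: Lam_small; lra.
have e0 := Lam0 _ Le.
have [||z [Zz c1z zc2]] := Zdense _ Le (c1 + (c2 - c1) / 4); [lra|lra|].
have [||w [zw wc2 nZw]] := Znint _ Le z c2 _ _ c2b; [lra|lra|].
have [y [Zy zy yw gapy]] := closed_last (Zcl _ Le) Zz zw nZw.
have [e' [Le' e'w]] : exists e', Lam e' /\ e' < w - y by apply: Lam_small; lra.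
have e'0 := Lam0 _ Le'.
exists y; split; last first.
  by apply: dB; rewrite /ball /= ltr_norml; lra.
split; last by rewrite /= in_itv /=; lra.
exists (Num.min e e'); split; first by rewrite lt_min e0.
exists e, e'; rewrite !ge_min !lexx orbT; do 3 (split=> //).
- lra.
- lra.
- by move=> v yv ve'; apply: gapy => //; lra.
Qed.

End OmegaOrderable.

(** * Thin families on the real line *)

Section OneDimensional.
Variables (R : realType) (L : language) (M : structure L R).
Hypothesis hM : expands_ordered_group M.
Variables (X : R -> R -> R -> Prop) (a b : R).
Hypothesis ab : a < b.
Hypothesis X_pos : forall r s x, X r s x -> 0 < r /\ 0 < s.
Hypothesis X_def : definable3 M X.
Hypothesis X_closed : forall r s, closed (X r s).
Hypothesis X_mono : forall r s r' s', r <= r' -> s' <= s -> 0 < s' ->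
  X r s `<=` X r' s'.
Hypothesis X_dense : forall c d, a <= c -> c < d -> d <= b ->
  exists r s x, [/\ X r s x, c < x & x < d].
Hypothesis X_thin : forall r s, no_interval (X r s) a b.

(** Either some [K r s] is infinite, and its gaps serve; or for some [s] the
    finite sets [K r s] grow with [r] to an infinite union; or the unions [K' s]
    are all finite, and themselves grow to an infinite union as [s] decreases. *)
Lemma definable_vanishing_set : exists Lam, definable1 M Lam /\ vanishing Lam.
Proof.
have X_defab : definable3 M (fun r s x => X r s x /\ a <= x <= b).
  apply: (@definable_pred_ext _ _ _ _
    (fun v => X (v ord0) (v (inord 1)) (v ord_max) /\
      (a <= v ord_max /\ v ord_max <= b))).
    by move=> v; split=> -[? /andP].
  by definability.
pose K r s x := X r s x /\ a <= x <= b.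
have Kdef : definable3 M K by [].
have [[r [s Kinf]]|Kfin] := pselect (exists r s, infinite_set (K r s)).
  exists [set l | exists x, gap (K r s) x l]; split.
    by rewrite /gap /mkset; definability.
  apply: (@gap_lengths_vanishing _ _ a b) => //.
  - have -> : K r s = X r s `&` `[a, b]%classic.
      by apply/seteqP; split=> y; rewrite /K /= in_itv.
    by apply: closedI => //; exact: interval_closed.
  - by move=> x [].
  - move=> x y ax xy yb; have [w [xw wy nw]] := X_thin r s ax xy yb.
    by exists w; split=> // -[].
have {}Kfin r s : finite_set (K r s).
  by apply: contrapT => inf; apply: Kfin; exists r, s.
pose K' s x := exists r, K r s x.
have K'def : definable2 M K' by rewrite /K'; definability.
have [[s Kinf]|K'fin] := pselect (exists s, infinite_set (K' s)).
  have s0 : 0 < s.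
    by have [x [r [/X_pos[]]]] := infinite_setN0 Kinf.
  exists [set l | 0 < l /\ exists r, 0 < r /\ min_distance (K r s) l]; split.
    by rewrite /min_distance /mkset; definability.
  apply: (@min_distances_vanishing _ _ (fun r => K r s) a b).
  - move=> r r' _ _; have [rr'|/ltW r'r] := leP r r'; [left|right];
      by move=> x [Xx ?]; split=> //; apply: X_mono Xx.
  - by [].
  - by move=> r _ x [].
  - apply: contra_not Kinf; apply: sub_finite_set => x [r Kx].
    by exists r; split=> //; have [/X_pos[]] := Kx.
have {}K'fin s : finite_set (K' s).
  by apply: contrapT => inf; apply: K'fin; exists s.
exists [set l | 0 < l /\ exists s, 0 < s /\ min_distance (K' s) l]; split.
  by rewrite /min_distance /mkset; definability.
apply: (@min_distances_vanishing _ _ K' a b) => //.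
- move=> s s' s0 s'0; have [ss'|/ltW s's] := leP s s'; [right|left];
    by move=> x [r [Xx ?]]; exists r; split=> //; apply: X_mono Xx.
- by move=> s _ x [r []].
(* A finite union could not be dense: nothing would lie between [a] and its
   least element above [a]. *)
move=> fin; pose U x := [/\ exists r s, X r s x, a < x & x < b].
have Ufin : finite_set U.
  apply: sub_finite_set fin => x [[r [s Xx]] ax xb]; exists s; split.
    by have [] := X_pos Xx.
  by exists r; split=> //; rewrite !ltW.
have [|||x [[_ ax xb] minx]] :=
    @finite_minimal R (fun x y => x < y) U _ _ Ufin.
- by move=> x _; rewrite ltxx.
- by move=> x y z _ _ _; exact: lt_trans.
- have [r [s [x [Xx ax xb]]]] := X_dense (lexx a) ab (lexx b).
  by exists x; split=> //; exists r, s.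
have [r [s [y [Xy ay yx]]]] := X_dense (lexx a) ax (ltW xb).
by apply: (minx y) => //; split=> //; [exists r, s|exact: lt_trans xb].
Qed.

Definition coarsely_dense e r s : Prop :=
  forall c, a <= c -> c + e <= b -> exists z, [/\ X r s z, c <= z & z <= c + e].

Lemma coarsely_dense_mono e r s r' s' : r <= r' -> s' <= s -> 0 < s' ->
  coarsely_dense e r s -> coarsely_dense e r' s'.
Proof.
move=> rr' ss' s'0 h c ac cb; have [z [Xz cz zc]] := h c ac cb.
by exists z; split=> //; exact: X_mono Xz.
Qed.

(** Cut [[a, b]] into pieces of length [e / 2]. Each piece meets some member,
    by monotonicity one member meets them all, and an interval of length [e]
    contains a whole piece. *)
Lemma coarsely_dense_exists e : 0 < e ->
  exists r s, [/\ 0 < r, 0 < s & coarsely_dense e r s].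
Proof.
move=> e0; pose h := e / 2; have h0 : 0 < h by rewrite /h; lra.
have step k : exists r s, [/\ 0 < r, 0 < s & forall i : nat, (i < k)%N ->
    a + i%:R * h + h <= b ->
    exists z, [/\ X r s z, a + i%:R * h <= z & z <= a + i%:R * h + h]].
  elim: k => [|k [r [s [r0 s0 IH]]]]; first by exists 1, 1.
  have [kb|kb] := leP (a + k%:R * h + h) b; last first.
    exists r, s; split=> // i; rewrite ltnS leq_eqVlt => /orP[/eqP ->|/IH//].
    by rewrite leNgt kb.
  have [|//|r' [s' [z [Xz kz zk]]]] :=
      @X_dense (a + k%:R * h) (a + k%:R * h + h) _ _ kb.
  - by rewrite lerDl mulr_ge0 // ltW.
  - lra.
  have [r'0 s'0] := X_pos Xz.
  have m0 : 0 < Num.min s s' by rewrite lt_min s0.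
  exists (Num.max r r'), (Num.min s s'); split=> //; first by rewrite lt_max r0.
  move=> i; rewrite ltnS leq_eqVlt => /orP[/eqP ->|ik] ib.
    exists z; split; [|exact: ltW|exact: ltW].
    by apply: X_mono Xz => //; rewrite ?le_max ?ge_min lexx ?orbT.
  have [y [Xy iy yi]] := IH _ ik ib; exists y; split=> //.
  by apply: X_mono Xy => //; rewrite ?le_max ?ge_min lexx.
have [r [s [r0 s0 rsP]]] := step (Num.truncn ((b - a) / h)).+2.
exists r, s; split=> // c ac cb; pose t := Num.truncn ((c - a) / h).
have q0 : 0 <= (c - a) / h by rewrite divr_ge0 ?subr_ge0 // ltW.
have tq : t%:R <= (c - a) / h by rewrite truncn_le.
have qt : (c - a) / h < t%:R + 1 by rewrite natr1 -truncn_lt_nat.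
have {}tq : t%:R * h <= c - a by rewrite -ler_pdivlMr.
have {}qt : c - a < t%:R * h + h.
  by move: qt; rewrite ltr_pdivrMr // mulrDl mul1r.
have [|| z [Xz tz zt]] := rsP t.+1.
- rewrite !ltnS; apply: le_truncn; rewrite ler_pM2r ?invr_gt0 //.
  by rewrite /h in h0 *; lra.
- by rewrite -natr1 mulrDl mul1r; rewrite /h in tq qt *; lra.
move: tz zt; rewrite -natr1 mulrDl mul1r => tz zt.
by exists z; split=> //; rewrite /h in tq qt tz zt *; lra.
Qed.

(** [r] exceeds by [1] the infimum of the first indices of coarsely dense
    members. These indices form an up-closed set, so [r] is one of them. *)
Definition selected_r e r : Prop :=
  exists g, [/\ r = g + 1,
    forall r', (0 < r' /\ exists s, 0 < s /\ coarsely_dense e r' s) -> g <= r'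
  & forall u, (forall r', (0 < r' /\ exists s, 0 < s /\ coarsely_dense e r' s) ->
      u <= r') -> u <= g].

(** [s] is half of the supremum of the second indices, cut off at [1], that are
    admissible for the given [r]; these form a down-closed set. *)
Definition selected_s e r s : Prop :=
  (forall s', [/\ 0 < s', s' <= 1 & coarsely_dense e r s'] -> s' <= s + s) /\
  (forall u, (forall s', [/\ 0 < s', s' <= 1 & coarsely_dense e r s'] ->
     s' <= u) -> s + s <= u).

Lemma selected_unique e r s r' s' : selected_r e r -> selected_s e r s ->
  selected_r e r' -> selected_s e r' s' -> r' = r /\ s' = s.
Proof.
move=> [g [-> gl gg]] [sl sg] [g' [-> gl' gg']].
have -> : g' = g by apply/le_anti; rewrite gg // gg'.
move=> [sl' sg']; split=> //.
have : s + s = s' + s' by apply/le_anti; rewrite sg // sg'.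
lra.
Qed.

Lemma selection e : 0 < e ->
  exists r s, [/\ selected_r e r, selected_s e r s & coarsely_dense e r s].
Proof.
move=> e0; have [r0 [s0 [r00 s00 dense0]]] := coarsely_dense_exists e0.
pose A : set R := [set r | 0 < r /\ exists s, 0 < s /\ coarsely_dense e r s].
have A0 : A !=set0 by exists r0; split=> //; exists s0.
have Alb : has_lbound A by exists 0 => r [/ltW].
have [r1 [r1_0 [s1 [s1_0 dense1]]] r1inf] :
    exists2 r, A r & r < inf A + 1 by apply: inf_adherent.
pose r := inf A + 1.
pose B : set R := [set s | [/\ 0 < s, s <= 1 & coarsely_dense e r s]].
have B1 : B (Num.min s1 1).
  split; [by rewrite lt_min s1_0 ltr01|by rewrite ge_min lexx orbT|].
  apply: coarsely_dense_mono dense1; [exact: ltW|by rewrite ge_min lexx|].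
  by rewrite lt_min s1_0 ltr01.
have Bub : has_ubound B by exists 1 => s [].
have sup0 : 0 < sup B by apply: lt_le_trans (ub_le_sup Bub B1); have [] := B1.
exists r, (sup B / 2); split.
- exists (inf A); split=> // [r' Ar'|u lbu]; first exact: ge_inf.
  exact: lb_le_inf.
- rewrite /selected_s -splitr; split=> [s'|u ubu]; first exact: ub_le_sup.
  by apply: ge_sup => //; exists (Num.min s1 1).
- have [s2 [s2_0 _ dense2] s2sup] : exists2 s, B s & sup B - sup B / 2 < s.
    by apply: sup_adherent; [lra|split=> //; exists (Num.min s1 1)].
  by apply: coarsely_dense_mono dense2 => //; lra.
Qed.

(** The selected members, indexed by a vanishing set, meet the requirements of
    [dense_omega_orderable]. *)
Lemma thin_family_dense_omega_orderable : defines_dense_omega_orderable_set M.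
Proof.
have [Lam [Lamdef Lamv]] := definable_vanishing_set.
have Lam0 : forall e, Lam e -> 0 < e by case: Lamv.
pose Z e x := exists r s, [/\ selected_r e r, selected_s e r s & X r s x].
have Zdef : definable2 M Z.
  have cd : definable3 M coarsely_dense by rewrite /coarsely_dense; definability.
  have rd : definable2 M selected_r by rewrite /selected_r; definability.
  have sd : definable3 M selected_s by rewrite /selected_s; definability.
  by rewrite /Z; definability.
have ZE e : Lam e -> exists r s, Z e = X r s /\ coarsely_dense e r s.
  move=> /Lam0 e0; have [r [s [er ers dense]]] := selection e0.
  exists r, s; split=> //; apply/seteqP; split=> x; last by exists r, s.
  move=> [r' [s' [er' ers' Xx]]].
  by have [<- <-] := selected_unique er ers er' ers'.
apply: (@dense_omega_orderable _ _ _ hM Lam Z a b) => // e /ZE[r [s [-> dense]]].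
- exact: X_closed.
- exact: X_thin.
- exact: dense.
Qed.

End OneDimensional.

(** * Baire category in row vectors *)

HB.instance Definition _ (R : realType) (n : nat) := Complete.on 'rV[R]_n.

(** A relative form of the Baire category theorem: adding the exterior of [V] to
    each [O t] makes it dense in the whole space. *)
Lemma locally_dense_countable_intersection (R : realType) (n : nat)
    (T : countType) (V : set 'rV[R]_n) (O : T -> set 'rV[R]_n) :
  open V -> V !=set0 -> (forall t, open (O t)) ->
  (forall t V', open V' -> V' !=set0 -> V' `<=` V -> V' `&` O t !=set0) ->
  exists x, V x /\ forall t, O t x.
Proof.
move=> oV V0 oO dO.
pose W i := if unpickle i is Some t then O t `|` ~` closure V else setT.
have WP i : open (W i) /\ dense (W i).
  rewrite /W; case: unpickle => [t|]; last first.
    by split; [exact: openT|move=> A A0 _; rewrite setIT].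
  split; first by apply: openU => //; apply: closed_openC; exact: closed_closure.
  move=> A A0 oA; have [AV0|AV0] := pselect (A `&` V !=set0).
    have [x [[Ax Vx] Ox]] := dO t _ (openI oA oV) AV0 (@subIsetr _ _ _).
    by exists x; split=> //; left.
  have [x Ax] := A0; exists x; split=> //; right => clx; apply: AV0.
  by have [y [Vy Ay]] := clx A (open_nbhs_nbhs (conj oA Ax)); exists y.
have [x [Vx Wx]] := Baire WP V0 oV; exists x; split=> // t.
have := Wx (pickle t) I; rewrite /W pickleK => -[//|]; case.
exact: subset_closure.
Qed.

(** * Fibers and projections *)

Section Cylinders.
Variables (R : realType) (n : nat).
Implicit Types (y : R) (x : 'rV[R]_n) (z : 'rV[R]_n.+1).

Definition cons_rV y x : 'rV[R]_n.+1 := \row_i extend y (x ord0) i.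

Definition head_rV z : R := z ord0 ord0.

Definition tail_rV z : 'rV[R]_n := \row_i z ord0 (lift ord0 i).

Lemma cons_head_tail z : cons_rV (head_rV z) (tail_rV z) = z.
Proof.
apply/rowP => i; rewrite mxE /extend; case: unliftP => [j|] -> //.
by rewrite mxE.
Qed.

Lemma head_cons y x : head_rV (cons_rV y x) = y.
Proof. by rewrite /head_rV mxE extend0. Qed.

Lemma tail_cons y x : tail_rV (cons_rV y x) = x.
Proof. by apply/rowP => i; rewrite !mxE extend_lift. Qed.

Lemma ball_cons_rV y x (e : R) y' x' : ball y e y' -> ball x e x' ->
  ball (cons_rV y x) e (cons_rV y' x').
Proof.
move=> yy' [e0 xx']; split=> // i j; rewrite !mxE /extend.
by case: unliftP => // k _; rewrite !(ord1 i).
Qed.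

Lemma ball_head_tail z (e : R) z' : ball z e z' ->
  ball (head_rV z) e (head_rV z') /\ ball (tail_rV z) e (tail_rV z').
Proof.
move=> [e0 zz']; split; first exact: zz'.
by split=> // i j; rewrite !mxE.
Qed.

Lemma near_cons_rV y x (B : set 'rV[R]_n.+1) : nbhs (cons_rV y x) B ->
  \forall y' \near y & x' \near x, B (cons_rV y' x').
Proof.
move=> /nbhs_ballP[e /= e0 eB]; exists (ball y e, ball x e).
  by split; exact: nbhsx_ballx.
by move=> [y' x'] /= [yy' xx']; apply: eB; exact: ball_cons_rV.
Qed.

Lemma nbhs_cylinder y x (A : set R) (B : set 'rV[R]_n) : nbhs y A -> nbhs x B ->
  nbhs (cons_rV y x) [set z | A (head_rV z) /\ B (tail_rV z)].
Proof.
move=> /nbhs_ballP[e /= e0 eA] /nbhs_ballP[d /= d0 dB].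
apply/nbhs_ballP; exists (Num.min e d); first by rewrite /= lt_min e0.
move=> z /ball_head_tail[]; rewrite head_cons tail_cons => yz xz.
split; [apply: eA|apply: dB].
  by apply: le_ball yz; rewrite ge_min lexx.
by apply: le_ball xz; rewrite ge_min lexx orbT.
Qed.

Lemma closed_fiber_head x (A : set 'rV[R]_n.+1) :
  closed A -> closed [set y | A (cons_rV y x)].
Proof.
move=> Acl y cly; apply: Acl => B /near_cons_rV[[P Q] /= [yP xQ] PQB].
have [y' [Ay' Py']] := cly P yP; exists (cons_rV y' x); split=> //.
by apply: (PQB (y', x)); split=> //=; exact: nbhs_singleton.
Qed.

Lemma closed_fiber_tail y (A : set 'rV[R]_n.+1) :
  closed A -> closed [set x | A (cons_rV y x)].
Proof.
move=> Acl x clx; apply: Acl => B /near_cons_rV[[P Q] /= [yP xQ] PQB].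
have [x' [Ax' Qx']] := clx Q xQ; exists (cons_rV y x'); split=> //.
by apply: (PQB (y, x')); split=> //=; exact: nbhs_singleton.
Qed.

(** Projections along the compact interval [[p, q]] preserve closedness. *)
Lemma closed_projection (A : set 'rV[R]_n.+1) (p q : R) : closed A ->
  closed [set x | exists y, (p <= y /\ y <= q) /\ A (cons_rV y x)].
Proof.
move=> Acl x clx; apply: contrapT => nx.
have /compact_near_coveringP cov := @segment_compact R p q.
have : nbhs x [set x' | `[p, q]%classic `<=` [set y | ~ A (cons_rV y x')]].
  apply: (cov _ (nbhs x) (fun x' y => ~ A (cons_rV y x'))).
  move=> y; rewrite /= in_itv /= => /andP[py yq].
  apply: (@near_cons_rV y x (~` A)); apply: open_nbhs_nbhs; split.
    exact: closed_openC.
  by move=> Ayx; apply: nx; exists y.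
move=> /clx[x' [[y [[py yq] Ay]] /(_ y)]] /=; apply => //.
by rewrite in_itv /= py.
Qed.

End Cylinders.

(** * Induction on the dimension *)

Section Induction.
Variables (R : realType) (L : language) (M : structure L R).
Hypothesis hM : expands_ordered_group M.
Hypothesis hD : ~ defines_dense_omega_orderable_set M.

Definition definable_pair_family n (X : R -> R -> set 'rV[R]_n) : Prop :=
  definable_pred M (fun v : 'I_(2 + n) -> R =>
    X (v (lshift n ord0)) (v (lshift n ord_max)) (\row_i v (rshift 2 i))).

Lemma definable_pair_family_comp n (X : R -> R -> set 'rV[R]_n) m
    (r s : ('I_m -> R) -> R) (x : 'I_n -> ('I_m -> R) -> R) :
  definable_pair_family X -> definable_term M r -> definable_term M s ->
  (forall i, definable_term M (x i)) ->
  definable_pred M (fun v => X (r v) (s v) (\row_i x i v)).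
Proof.
move=> Xdef hr hs hx.
pose t (j : 'I_(2 + n)) := match fintype.split j with
  | inl k => if val k is 0%N then r else s
  | inr i => x i end.
have tl (k : 'I_2) : t (lshift n k) = if val k is 0%N then r else s.
  by rewrite /t -[lshift n k]/(unsplit (inl k)) unsplitK.
have tr i : t (rshift 2 i) = x i.
  by rewrite /t -[rshift 2 i]/(unsplit (inr i)) unsplitK.
have tdef j : definable_term M (t j).
  by rewrite /t; case: fintype.split => [[[|k] ?]|].
apply: definable_pred_ext (definable_comp Xdef tdef) => v.
rewrite !tl /=; suff -> : \row_i t (rshift 2 i) v = \row_i x i v by [].
by apply/rowP => i; rewrite !mxE tr.
Qed.

(** Members with an index that is not positive are empty, by [family_pos]; the
    other conditions can then be stated for all real indices. *)
Record closed_monotone_family n (X : R -> R -> set 'rV[R]_n) : Prop := {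
  family_definable : definable_pair_family X;
  family_pos : forall r s x, X r s x -> 0 < r /\ 0 < s;
  family_closed : forall r s, closed (X r s);
  family_mono : forall r s r' s', r <= r' -> s' <= s -> 0 < s' ->
    X r s `<=` X r' s' }.

Definition projection n (X : R -> R -> set 'rV[R]_n.+1) (p q : R)
    (r s : R) : set 'rV[R]_n :=
  [set x | exists y, (p <= y /\ y <= q) /\ X r s (cons_rV y x)].

Lemma projection_family n (X : R -> R -> set 'rV[R]_n.+1) p q :
  closed_monotone_family X -> closed_monotone_family (projection X p q).
Proof.
move=> [Xdef Xpos Xcl Xmono]; split.
- rewrite /definable_pair_family /projection /mkset.
  apply: (@definable_ex _ _ _ _ (fun v y => (p <= y /\ y <= q) /\
    X (v (lshift n ord0)) (v (lshift n ord_max))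
      (cons_rV y (\row_i v (rshift 2 i))))).
  pose t (i : 'I_n.+1) (w : 'I_(2 + n).+1 -> R) :=
    if unlift ord0 i is Some j then w (lift ord0 (rshift 2 j)) else w ord0.
  have tdef i : definable_term M (t i).
    by rewrite /t; case: unlift => [j|]; exact: definable_var.
  have Xt := definable_pair_family_comp Xdef
    (definable_var M (lift ord0 (lshift n (ord0 : 'I_2))))
    (definable_var M (lift ord0 (lshift n (ord_max : 'I_2)))) tdef.
  apply: definable_and; first by definability.
  apply: definable_pred_ext Xt => w.
  suff -> : \row_i t i w = cons_rV (w ord0) (\row_i w (lift ord0 (rshift 2 i))).
    by [].
  by apply/rowP => i; rewrite !mxE /t /extend; case: unlift => // j; rewrite mxE.
- by move=> r s x [y [_ /Xpos]].
- by move=> r s; exact: closed_projection.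
- move=> r s r' s' rr' ss' s'0 x [y [pqy Xy]]; exists y; split=> //.
  exact: Xmono Xy.
Qed.

Lemma fiber_definable n (X : R -> R -> set 'rV[R]_n.+1) (x : 'rV[R]_n) :
  definable_pair_family X -> definable3 M (fun r s y => X r s (cons_rV y x)).
Proof.
move=> Xdef.
pose t (i : 'I_n.+1) (w : 'I_3 -> R) :=
  if unlift ord0 i is Some j then x ord0 j else w ord_max.
have tdef i : definable_term M (t i).
  by rewrite /t; case: unlift => [j|]; [exact: definable_par|exact: definable_var].
have Xt := definable_pair_family_comp Xdef
  (definable_var M ord0) (definable_var M (inord 1)) tdef.
apply: definable_pred_ext Xt => w.
suff -> : \row_i t i w = cons_rV (w ord_max) x by [].
by apply/rowP => i; rewrite !mxE /t /extend; case: unlift.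
Qed.

(** Locating the interior inside [U] makes the property applicable to every
    smaller open set, which shows that the interiors are dense in [U]. *)
Definition some_member_has_interior n : Prop :=
  forall (X : R -> R -> set 'rV[R]_n) (U : set 'rV[R]_n),
  closed_monotone_family X -> open U -> U !=set0 ->
  dense_in [set x | exists r s, X r s x] U ->
  exists r s, (interior (X r s) `&` U) !=set0.

Lemma some_member_has_interior0 : some_member_has_interior 0.
Proof.
move=> X U _ oU [x Ux] dU.
have [y [[[r [s Xy]] Uy] _]] := dU x Ux setT filterT.
exists r, s, y; split=> //; apply: filterS (@filterT _ (nbhs y) _) => z _.
suff -> : z = y by [].
by apply/rowP => -[].
Qed.

(** [Op p q] collects the interiors of the projections over [[p, q]]; [C k p q]
    is the set of points over which the [k]-th cofinal member contains
    [[p, q]]. A point of all [Op p q] outside all [C k p q] has a fiber to which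
    [thin_family_dense_omega_orderable] applies. *)
Lemma some_member_has_interiorS n :
  some_member_has_interior n -> some_member_has_interior n.+1.
Proof.
move=> IH X U XF oU [z0 Uz0] dU; apply: contrapT => thin.
have [Xdef Xpos Xcl Xmono] := XF.
have {}thin r s z : U z -> ~ nbhs z (X r s).
  by move=> Uz Xz; apply: thin; exists r, s, z.
have /nbhs_ballP[e /= e0 eU] : nbhs z0 U by exact: open_nbhs_nbhs.
pose y0 := head_rV z0; pose V := (ball (tail_rV z0) e)°.
have oV : open V by exact: open_interior.
have V0 : V !=set0 by exists (tail_rV z0); exact: nbhsx_ballx.
have VU y x : y0 - e < y -> y < y0 + e -> V x -> U (cons_rV y x).
  move=> ey ye /interior_subset xV; apply: eU; rewrite -(cons_head_tail z0).
  by apply: ball_cons_rV => //; rewrite /ball /= -/y0 ltr_norml; lra.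
pose inside (p q : R) := [/\ y0 - e < p, p < q & q < y0 + e].
pose P (p q : rat) := projection X (ratr p) (ratr q).
pose Op p q : set 'rV[R]_n := \bigcup_(rs in [set: R * R]) (P p q rs.1 rs.2)°.
pose C (k : nat) (p q : rat) : set 'rV[R]_n :=
  \bigcap_(y in [set y : R | ratr p <= y <= ratr q])
     [set x | X k.+1%:R k.+1%:R^-1 (cons_rV y x)].
pose O (t : nat * rat * rat) : set 'rV[R]_n :=
  [set x | inside (ratr t.1.2) (ratr t.2) ->
     (Op t.1.2 t.2 `&` ~` C t.1.1 t.1.2 t.2) x].
have oOp p q : open (Op p q) by apply: bigcup_open => rs _; exact: open_interior.
have Ccl k p q : closed (C k p q).
  by apply: closed_bigI => y _; exact: closed_fiber_tail.
have oO t : open (O t).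
  have [ins|nins] := pselect (inside (ratr t.1.2) (ratr t.2)).
    have -> : O t = Op t.1.2 t.2 `&` ~` C t.1.1 t.1.2 t.2.
      by apply/seteqP; split=> x; [exact|move=> Ox _].
    by apply: openI => //; exact: closed_openC.
  have -> : O t = setT by rewrite -subTset => x _ /nins.
  exact: openT.
(* The midpoint of [p] and [q] places a given point of the base inside the open
   cylinder over ]p, q[. *)
have cylinder (x : 'rV[R]_n) (p q : R) (V' : set 'rV[R]_n) : p < q ->
    open V' -> V' x ->
    nbhs (cons_rV ((p + q) / 2) x)
      [set z | `]p, q[%classic (head_rV z) /\ V' (tail_rV z)].
  move=> pq oV' V'x; apply: nbhs_cylinder; last exact: open_nbhs_nbhs.
  apply: open_nbhs_nbhs; split; first exact: interval_open.
  by rewrite /= in_itv /=; lra.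
have dOp p q V' : inside (ratr p) (ratr q) -> open V' -> V' !=set0 ->
    V' `<=` V -> V' `&` Op p q !=set0.
  move=> [ep pq qe] oV' V'0 V'V.
  suff [r [s [x [Px V'x]]]] : exists r s, ((P p q r s)° `&` V') !=set0.
    by exists x; split=> //; exists (r, s).
  apply: IH => //; first exact: projection_family.
  move=> x V'x B; rewrite nbhsE => -[B' [oB' B'x] B'B].
  have UQ : U (cons_rV ((ratr p + ratr q) / 2) x).
    by apply: VU; [lra|lra|exact: V'V].
  have := cylinder x _ _ _ pq (openI oV' oB') (conj V'x B'x).
  move=> /(dU _ UQ)[z [[[r [s Xz]] _] [/= + [V'z B'z]]]].
  rewrite in_itv /= => /andP[/ltW pz /ltW zq].
  exists (tail_rV z); split; last exact: B'B.
  by split=> //; exists r, s, (head_rV z); split=> //; rewrite cons_head_tail.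
have dC k p q V' : inside (ratr p) (ratr q) -> open V' -> V' !=set0 ->
    V' `<=` V -> V' `&` ~` C k p q !=set0.
  move=> [ep pq qe] oV' [x V'x] V'V; apply: contrapT => none.
  have V'C : V' `<=` C k p q.
    by move=> x' V'x'; apply: contrapT => nC; apply: none; exists x'.
  have UQ : U (cons_rV ((ratr p + ratr q) / 2) x).
    by apply: VU; [lra|lra|exact: V'V].
  apply: (thin k.+1%:R k.+1%:R^-1 _ UQ).
  apply: filterS (cylinder x _ _ _ pq oV' V'x) => z [/= + V'z].
  rewrite in_itv /= => /andP[/ltW pz /ltW zq].
  by rewrite -(cons_head_tail z); apply: V'C => //=; rewrite pz.
have dO t V' : open V' -> V' !=set0 -> V' `<=` V -> V' `&` O t !=set0.
  move=> oV' V'0 V'V.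
  have [ins|nins] := pselect (inside (ratr t.1.2) (ratr t.2)); last first.
    by have [x V'x] := V'0; exists x; split=> // /nins.
  have V'O0 := dOp _ _ _ ins oV' V'0 V'V.
  have [|x [[V'x Ox] Cx]] := dC t.1.1 _ _ _ ins (openI oV' (oOp _ _)) V'O0.
    by move=> x [/V'V].
  by exists x; split=> // _; split.
have [x [Vx Ox]] := locally_dense_countable_intersection oV V0 oO dO.
apply: hD.
apply: (@thin_family_dense_omega_orderable _ _ _ hM
  (fun r s y => X r s (cons_rV y x)) (y0 - e / 2) (y0 + e / 2)).
- lra.
- by move=> r s y /Xpos.
- exact: fiber_definable.
- by move=> r s; exact: closed_fiber_head.
- by move=> r s r' s' rr' ss' s'0 y; exact: Xmono.
- move=> c d ac cd db; have [p /itvP pI] := rat_in_itvoo cd.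
  have [|q /itvP qI] := @rat_in_itvoo R (ratr p) d; first by rewrite pI.
  have cp : c < ratr p by rewrite pI.
  have pq : ratr p < ratr q :> R by rewrite qI.
  have qd : ratr q < d by rewrite qI.
  have [|[[r s] _ /interior_subset[y [[py yq] Xy]]] _] := Ox (0%N, p, q).
    by split=> /=; lra.
  by exists r, s, y; split=> //; lra.
- move=> r s c d ac cd db; apply: contrapT => full.
  have {}full y : c < y -> y < d -> X r s (cons_rV y x).
    by move=> cy yd; apply: contrapT => nX; apply: full; exists y.
  have [p /itvP pI] := rat_in_itvoo cd.
  have [|q /itvP qI] := @rat_in_itvoo R (ratr p) d; first by rewrite pI.
  have cp : c < ratr p by rewrite pI.
  have pq : ratr p < ratr q :> R by rewrite qI.
  have qd : ratr q < d by rewrite qI.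
  have [r0 s0] : 0 < r /\ 0 < s.
    by apply: (Xpos _ _ (cons_rV ((c + d) / 2) x)); apply: full; lra.
  (* The [k]-th cofinal member contains [X r s]. *)
  pose k := Num.truncn (Num.max r s^-1).
  have : Num.max r s^-1 < k.+1%:R.
    by rewrite -truncn_lt_nat // le_max (ltW r0).
  rewrite gt_max => /andP[/ltW rk /ltW sk].
  have [|_] := Ox (k, p, q); first by split=> /=; lra.
  apply=> y /= /andP[py yq]; apply: (Xmono r s) => //.
  + by rewrite invf_ple // posrE.
  + by apply: full; lra.
Qed.

Lemma some_member_has_interiorP n : some_member_has_interior n.
Proof.
elim: n => [|n IH]; first exact: some_member_has_interior0.
exact: some_member_has_interiorS.
Qed.

End Induction.

Theorem mainTheorem5 (R : realType) (L : language) (M : structure L R)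
    (hM : expands_ordered_group M)
    (hD : ~ defines_dense_omega_orderable_set M)
    (n : nat) (X : R -> R -> set 'rV[R]_n)
    (hX : definable_family M X)
    (hclosed : forall r s : R, 0 < r -> 0 < s -> closed (X r s))
    (hmono : forall r s r' s' : R, 0 < r -> 0 < s -> 0 < r' -> 0 < s' ->
       r <= r' -> s' <= s -> X r s `<=` X r' s')
    (hdense : somewhere_dense
       [set x : 'rV[R]_n | exists r s : R, [/\ 0 < r, 0 < s & X r s x]]) :
  exists r' s' : R, [/\ 0 < r', 0 < s' & interior (X r' s') !=set0].
Proof.
(* Discarding the members with an index that is not positive changes neither
   the union nor the relevant members. *)
pose X' r s : set 'rV[R]_n := [set x | [/\ 0 < r, 0 < s & X r s x]].
have X'F : closed_monotone_family M X'.
  split.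
  - have [phi phiP] := hX; exists phi => v.
    have := phiP (\row_j v j); rewrite /= !mxE.
    have -> : (\row_j v j) ord0 = v by apply/funext => j; rewrite mxE.
    suff -> : rsubmx (\row_j v j) = \row_i v (rshift 2 i) by [].
    by apply/rowP => i; rewrite !mxE.
  - by move=> r s x [].
  - move=> r s; have [[r0 s0]|nrs] := pselect (0 < r /\ 0 < s).
      have -> : X' r s = X r s by apply/seteqP; split=> x // [].
      exact: hclosed.
    have -> : X' r s = set0 by rewrite -subset0 => x [r0 s0 _]; exact: nrs.
    exact: closed0.
  - move=> r s r' s' rr' ss' s'0 x [r0 s0 Xx]; have r'0 := lt_le_trans r0 rr'.
    by split=> //; apply: hmono Xx.
have [U [oU U0 dU]] := hdense.
have [r [s [x [Xx _]]]] := some_member_has_interiorP hM hD X'F oU U0 dU.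
have [r0 s0 _] := interior_subset Xx.
by exists r, s; split=> //; exists x; apply: interiorS Xx => y [].
Qed.
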